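(* Fix $n\ge 2$ and $m=2n$. Let $X_{m-1}\subset\mathbb{P}^{m-1}$ be the hypersurface defined by $e_{m-1}(x_1,\dots,x_m)=0$. Then all the $(m-1)!!$ isolated projective $(n-1)$-dimensional linear subspaces contained in $X_{m-1}$ correspond to realizable non-invertible star transforms; that is, for each such subspace $\Lambda$ there is a real $m\times n$ matrix $U$ with nonzero rows $u_1,\dots,u_m$ such that $\mathbb{P}(\mathrm{Im}(U))=\Lambda(\mathbb{R})$ and the star transform $\mathcal{S}=\mathcal{X}_{u_1}+\dots+\mathcal{X}_{u_m}$ with symbol $(e_1,U)$ is realizable on $\mathbb{R}^n$ and non-invertible.
   Context: Here $e_k$ is the elementary symmetric polynomial of degree $k$ in $m$ variables. The $(m-1)!!=m!/(2^n n!)$ isolated linear subspaces are those given by $x_{a_1}+x_{b_1}=\dots=x_{a_n}+x_{b_n}=0$, one for each perfect matching $\{\{a_1,b_1\},\dots,\{a_n,b_n\}\}$ of $\{1,\dots,m\}$; they are isolated points of the Fano scheme $F_{n-1}(X_{m-1})\subset G(n,m)$ parametrizing projective $(n-1)$-dimensional linear subspaces contained in $X_{m-1}$. For $u\in\mathbb{R}^n\setminus\{0\}$, the divergent beam transform is $(\mathcal{X}_u f)(x)=\int_{-\infty}^{0} f(x+tu)\,dt$. The star transform with symbol $(e_1,U)$ is $\mathcal{S}=\mathcal{X}_{u_1}+\dots+\mathcal{X}_{u_m}$, where $u_i$ are the rows of $U$. Realizable on $\mathbb{R}^n$ means the defining integrals converge for all $f\in C_c^\infty(\mathbb{R}^n)$,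 so that $\mathcal{S}$ is a linear map $C_c^\infty(\mathbb{R}^n)\to C^\infty(\mathbb{R}^n)$; non-invertible means that this map is not injective. $\mathrm{Im}(U)\subset\mathbb{R}^m$ is the column space of $U$. *)

(* Defs.v *)
From HB Require Import structures.
From mathcomp Require Import all_boot all_order all_algebra.
From mathcomp Require Import complex.
(* Not imported: the notations of mpoly clash with those of analysis. *)
From mathcomp Require mpoly.
From mathcomp Require Import all_classical all_reals all_analysis.

Set Implicit Arguments.
Unset Strict Implicit.
Unset Printing Implicit Defensive.

Import Order.TTheory GRing.Theory Num.Theory.
Import numFieldNormedType.Exports.

Local Open Scope ring_scope.
Local Open Scope classical_set_scope.

(** * Linear subspaces of the hypersurface [e_(m-1) = 0]

A projective linear subspace of P^(m-1) is represented by the linear subspace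
of the affine space of column vectors of which it is the projectivization
(dimension goes up by one). *)

Definition elem_sym (F : fieldType) (m k : nat) (x : 'cV[F]_m) : F :=
  mpoly.meval (fun i => x i 0) (mpoly.mesym m F k).

Definition column_space (F : fieldType) (m n : nat) (U : 'M[F]_(m, n)) :
    {vspace 'cV[F]_m} :=
  limg (linfun (mulmx U : 'cV[F]_n -> 'cV[F]_m)).

(* A closed point of the Fano scheme F_(n-1)(X_(m-1)), where the base field is
   algebraically closed. *)
Definition fano_point (F : closedFieldType) (m n : nat)
    (V : {vspace 'cV[F]_m}) : Prop :=
  \dim V = n /\ forall x, x \in V -> elem_sym m.-1 x = 0.

(* The Grassmannian G(n, m) is the quotient by GL_n of the variety of m x n
   matrices of rank n, through [column_space], and carries the quotient of the
   Zariski topology; hence a basis of neighbourhoods of V is given by the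
   images of the basic open sets [p(B') <> 0], for p a polynomial in the
   entries such that p(B) <> 0 at some matrix B with column space V. *)
Definition isolated_fano_point (F : closedFieldType) (m n : nat)
    (V : {vspace 'cV[F]_m}) : Prop :=
  fano_point n V /\
  exists (p : mpoly.mpoly (m * n) F) (B : 'M[F]_(m, n)),
    [/\ column_space B = V,
        mpoly.meval (fun k => mxvec B 0 k) p != 0 &
        forall B' : 'M[F]_(m, n),
          mpoly.meval (fun k => mxvec B' 0 k) p != 0 ->
          fano_point n (column_space B') -> column_space B' = V].

Definition perfect_matchings (m : nat) : {set {set {set 'I_m}}} :=
  [set M : {set {set 'I_m}} |
    finset.partition M [set: 'I_m] && [forall A in M, #|A| == 2%N]].

Definition block_sum (F : fieldType) (m : nat) (A : {set 'I_m})
    (x : 'cV[F]_m) : F^o := \sum_(i in A) x i 0.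

Lemma block_sum_is_linear (F : fieldType) (m : nat) (A : {set 'I_m}) :
  linear (@block_sum F m A).
Proof.
move=> a x y; rewrite /block_sum scaler_sumr -big_split /=.
by apply: eq_bigr => i _; rewrite !mxE.
Qed.

HB.instance Definition _ (F : fieldType) (m : nat) (A : {set 'I_m}) :=
  GRing.isLinear.Build F 'cV[F]_m F^o _ (@block_sum F m A)
    (@block_sum_is_linear F m A).

(* The subspace x_a + x_b = 0 for {a, b} in M. *)
Definition matching_subspace (F : fieldType) (m : nat) (M : {set {set 'I_m}}) :
    {vspace 'cV[F]_m} :=
  (\bigcap_(A in M) lker (linfun (@block_sum F m A)))%VS.

(** * Test functions on R^n *)

Fixpoint Ck (R : realType) (n k : nat) (f : 'rV[R]_n -> R) : Prop :=
  match k with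
  | 0 => continuous f
  | k'.+1 => continuous f /\
      forall i : 'I_n,
        (forall x, derivable f x (delta_mx 0 i)) /\
        Ck k' (fun x => 'D_(delta_mx 0 i) f x)
  end.

Definition smooth (R : realType) (n : nat) (f : 'rV[R]_n -> R) : Prop :=
  forall k, Ck k f.

Definition test_functions (R : realType) (n : nat) : set ('rV[R]_n -> R) :=
  [set f | smooth f /\ compact (closure [set x | f x != 0])].

Arguments test_functions : clear implicits.

(** * Star transforms of symbol (e_1, U) *)

Definition beam (R : realType) (n : nat) (u : 'rV[R]_n) (f : 'rV[R]_n -> R)
    (x : 'rV[R]_n) : R :=
  \int[lebesgue_measure]_(t in `]-oo, (0 : R)]) f (x + t *: u).

Definition beam_converges (R : realType) (n : nat) (u : 'rV[R]_n)
    (f : 'rV[R]_n -> R) (x : 'rV[R]_n) : Prop :=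
  lebesgue_measure.-integrable `]-oo, (0 : R)]
    (fun t => (f (x + t *: u))%:E).

Definition star (R : realType) (m n : nat) (U : 'M[R]_(m, n))
    (f : 'rV[R]_n -> R) (x : 'rV[R]_n) : R :=
  \sum_(i < m) beam (row i U) f x.

Definition realizable (R : realType) (m n : nat) (U : 'M[R]_(m, n)) : Prop :=
  [/\ forall f, test_functions R n f ->
        forall i x, beam_converges (row i U) f x,
      forall f, test_functions R n f -> smooth (star U f) &
      forall (a : R) f g, test_functions R n f -> test_functions R n g ->
        forall x, star U (fun y => a * f y + g y) x
                  = a * star U f x + star U g x].

Definition non_invertible (R : realType) (m n : nat) (U : 'M[R]_(m, n)) :
    Prop :=
  ~ set_inj (test_functions R n) (star U).

(* Main.v *)
(** Label the blocks of the matching by [a_k], [b_k].  The subspace [x_b = - x_a]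
    is the column space of the matrix [U] whose rows are [e_k] at [a_k] and
    [- e_k] at [b_k].  On it the terms of [e_(m-1)] cancel in pairs.  A nearby
    subspace is a graph [x_b = D x_a] with nonzero diagonal entries [D_kk]: restricting
    [e_(m-1) = (prod_i x_i) (sum_i 1 / x_i)] to [x_(a_k) = 0] leaves a product of
    linear forms, one of which must vanish, which forces [D] to be diagonal, and
    then linear independence of the [1 / x_(a_k)] forces [D = -1].

    The star transform of [U] sums the integrals of [f] over the lines in the
    coordinate directions.  All of them vanish for [f x = prod_k psi' (x_k)]
    with [psi] a bump function, since every line integral has a factor
    [\int psi' = 0]. *)

Require Import Defs.
From HB Require Import structures.
From mathcomp Require Import all_boot all_order all_algebra.
From mathcomp Require Import complex zify ring lra.
From mathcomp Require Import (canonicals) mpoly.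

Set Implicit Arguments.
Unset Strict Implicit.
Unset Printing Implicit Defensive.

Import Order.TTheory GRing.Theory Num.Theory.

Local Open Scope ring_scope.

(** * Perfect matchings *)

Definition pair_partitions (T : finType) (D : {set T}) : {set {set {set T}}} :=
  [set P : {set {set T}} |
    partition P D && [forall A in P, #|A| == 2%N]].

Lemma pair_partitionsP (T : finType) (D : {set T}) (P : {set {set T}}) :
  reflect (partition P D /\ forall A : {set T}, A \in P -> #|A| = 2%N)
          (P \in pair_partitions D).
Proof.
rewrite inE; apply: (iffP andP) => -[pP cP]; split=> //.
  by move=> A AP; apply/eqP; exact: (forall_inP cP).
by apply/forall_inP => A AP; apply/eqP; exact: cP.
Qed.

(** Adding [B] as a block is injective on the pair partitions of [D :\: B], and its image consists
    of those of [D] whose block at [x] is [B]. *)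
Lemma card_pair_partitions_pblock (T : finType) (D B : {set T}) (x : T) :
  x \in B -> B \subset D -> #|B| = 2%N ->
  #|[set P in pair_partitions D | pblock P x == B]| =
  #|pair_partitions (D :\: B)|.
Proof.
move=> xB BD cB; have B0 : B != set0 by rewrite -card_gt0 cB.
have nB Q : Q \in pair_partitions (D :\: B) -> B \notin Q.
  move=> /pair_partitionsP[pQ _]; apply/negP => BQ.
  by have /subsetP/(_ _ xB) := partitionS pQ BQ; rewrite inE xB.
have inj : {in pair_partitions (D :\: B) &, injective (fun Q => B |: Q)}.
  by move=> Q1 Q2 /nB nQ1 /nB nQ2 /(congr1 (fun Q => Q :\ B)); rewrite !setU1K.
rewrite -(card_in_imset inj); apply: eq_card => P; apply/idP/imsetP.
  rewrite !inE => /andP[/andP[pP /forall_inP cP] /eqP xPB].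
  have BP : B \in P.
    by rewrite -xPB pblock_mem // (cover_partition pP) (subsetP BD).
  exists (P :\ B); last by rewrite setD1K.
  apply/pair_partitionsP; split; first exact: partitionD1.
  by move=> A /setD1P[_ AP]; apply/eqP/cP.
move=> [Q /pair_partitionsP[pQ cQ] ->].
have pP : partition (B |: Q) D.
  rewrite -(setID D B) (setIidPr BD); apply: partitionU1 => //.
  by rewrite -setI_eq0 setIDA setDIl setDv set0I.
rewrite inE (def_pblock (partition_trivIset pP) _ xB) ?setU11 // eqxx andbT.
apply/pair_partitionsP; split=> // A /setU1P[->//|]; exact: cQ.
Qed.

(** Induction on [n]: fix a point [x] and sort the partitions by the block of [x]. There are
    [2n + 1] possible partners, and each leaves a set of [2n] points. *)
Lemma card_pair_partitions (T : finType) (n : nat) (D : {set T}) :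
  #|D| = (2 * n)%N -> (#|pair_partitions D| * (2 ^ n * n`!) = (2 * n)`!)%N.
Proof.
elim: n D => [|n IHn] D cD.
  have -> : pair_partitions D = [set set0].
    apply/setP => P; rewrite !inE (cards0_eq cD) partition_set0.
    case: eqP => // ->; apply/forall_inP => A; by rewrite inE.
  by rewrite cards1.
have [x xD] : exists x, x \in D by apply/set0Pn; rewrite -card_gt0 cD mulnS.
pose Bs := [set [set x; y] | y in D :\ x].
have cBs : #|Bs| = (2 * n).+1.
  rewrite card_in_imset => [|y z /setD1P[yx _] /setD1P[zx _] /setP/(_ y)].
    by move: (cardsD1 x D); rewrite xD cD mulnS /= => -[].
  by rewrite !inE eqxx orbT (negPf yx) /= => /esym/eqP.
have BsP B : B \in Bs -> [/\ x \in B, B \subset D & #|B| = 2%N].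
  move=> /imsetP[y /setD1P[yx yD] ->]; rewrite set21 cards2 eq_sym yx.
  by split=> //; apply/subsetP => z /set2P[] ->.
have mBs P : P \in pair_partitions D -> pblock P x \in Bs.
  move=> /pair_partitionsP[pP cP].
  have xP : x \in cover P by rewrite (cover_partition pP).
  have xB : x \in pblock P x by rewrite mem_pblock.
  have /eqP := cP _ (pblock_mem xP); rewrite (cardsD1 x) xB eqSS.
  move=> /cards1P[y /setP Ey].
  have := Ey y; rewrite !inE eqxx => /andP[yx yB].
  apply/imsetP; exists y.
    rewrite !inE yx /=; apply: (subsetP (partitionS pP (pblock_mem xP))).
    exact: yB.
  apply/setP => z; have := Ey z; rewrite !inE.
  by case: (eqVneq z x) => [->|].
have -> : #|pair_partitions D| =
    (\sum_(B in Bs) #|[set P in pair_partitions D | pblock P x == B]|)%N.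
  rewrite -sum1_card (partition_big (pblock^~ x) (mem Bs)) //=.
  by apply: eq_bigr => B _; rewrite -sum1_card; apply: eq_bigl => P; rewrite inE.
have card2 B : B \in Bs -> (#|D :\: B| = 2 * n)%N.
  move=> /BsP[_ BD cB]; rewrite cardsD (setIidPr BD) cB cD.
  by rewrite mulnS addKn.
have [n2 n2E] : exists k, (2 * n = k)%N by exists (2 * n)%N.
(* Since [2 ^ n.+1 * n.+1]! = (2 * n.+1) * (2 ^ n * n[!)], every block contributes the same amount,
   and the [2n + 1] blocks supply the missing factor of the factorial. *)
rewrite big_distrl (eq_bigr (fun _ => (2 * n.+1) * (2 * n)`!)%N).
  by rewrite sum_nat_const cBs mulnS n2E add2n !factS mulnCA.
move=> B BBs; have [xB BD cB] := BsP _ BBs.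
rewrite card_pair_partitions_pblock // -(IHn (D :\: B)) ?card2 //=.
by rewrite expnS factS; nia.
Qed.

(** * The hypersurface [e_(m-1) = 0] *)

Lemma elem_sym_pred (F : fieldType) (m : nat) (x : 'cV[F]_m) : (0 < m)%N ->
  elem_sym m.-1 x = \sum_i \prod_(j | j != i) x j 0.
Proof.
move=> m0; rewrite /elem_sym /mpoly.mesym rmorph_sum /=.
(* The subsets of size [m - 1] are the complements of singletons. The inverse picks the missing
   index; its default [Ordinal m0] is never reached on such subsets. *)
rewrite (reindex_onto (fun i : 'I_m => ~: [set i])
                      (fun h : {set 'I_m} => odflt (Ordinal m0) [pick i | i \notin h])) /=.
  apply: eq_big => [i|i _].
    rewrite cardsC1 card_ord eqxx /=; case: pickP => [j|/(_ i)]; last first.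
      by rewrite !inE eqxx.
    by rewrite !inE negbK.
  rewrite rmorph_prod /=; apply: eq_big => j; first by rewrite !inE.
  by move=> _; rewrite mpoly.mevalXU.
move=> h /eqP ch; have : #|~: h| == 1%N.
  by rewrite -(eqn_add2l #|h|) cardsC ch card_ord addn1 prednK.
case/cards1P => i hi; have -> : h = ~: [set i] by rewrite -hi setCK.
case: pickP => [j|/(_ i)]; first by rewrite !inE negbK => /eqP ->.
by rewrite !inE eqxx.
Qed.

Lemma elem_sym_pred_neq0 (F : fieldType) (m : nat) (x : 'cV[F]_m) :
  (0 < m)%N -> (forall i, x i 0 != 0) ->
  elem_sym m.-1 x = (\prod_i x i 0) * \sum_i (x i 0)^-1.
Proof.
move=> m0 x0; rewrite elem_sym_pred // mulr_sumr; apply: eq_bigr => i _.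
by rewrite [in RHS](bigD1 i) //= mulrAC mulfV // mul1r.
Qed.

(** Every term except the one omitting [x i] contains the factor [x i]. *)
Lemma elem_sym_pred_eq0 (F : fieldType) (m : nat) (x : 'cV[F]_m) (i : 'I_m) :
  x i 0 = 0 -> elem_sym m.-1 x = \prod_(j | j != i) x j 0.
Proof.
move=> xi; rewrite elem_sym_pred ?(leq_trans _ (ltn_ord i)) //.
rewrite (bigD1 i) //= [X in _ + X]big1 ?addr0 // => j ji.
by rewrite (bigD1 i) 1?eq_sym //= xi mul0r.
Qed.

(** In characteristic 0 the first [size p] natural numbers are distinct, one more than the degree
    allows as roots. *)
Lemma exists_nonroot (F : numFieldType) (p : {poly F}) :
  p != 0 -> exists t, p.[t] != 0.
Proof.
move=> p0; pose s : seq F := [seq k%:R | k <- iota 0 (size p)].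
have us : uniq s.
  by rewrite map_inj_uniq ?iota_uniq // => j k /eqP; rewrite eqr_nat => /eqP.
have [rs|/allPn[t _ nt]] := boolP (all (root p) s); last by exists t.
by have := max_poly_roots p0 rs us; rewrite size_map size_iota ltnn.
Qed.

(** * Labelled matchings and their subspaces *)

(** A numbering of the blocks together with an order inside each block: [c (inl k)] is a_k and
    [c (inr k)] is b_k. The sum type lets sums and products over ['I_m] split into two over
    ['I_n]. *)
Definition labelling (m n : nat) (M : {set {set 'I_m}})
    (c : 'I_n + 'I_n -> 'I_m) : Prop :=
  bijective c /\ M = [set [set c (inl k); c (inr k)] | k : 'I_n].

Lemma labelling_exists (m n : nat) (M : {set {set 'I_m}}) :
  m = (2 * n)%N -> M \in perfect_matchings m ->
  exists c : 'I_n + 'I_n -> 'I_m, labelling M c.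
Proof.
move=> hm /(pair_partitionsP [set: 'I_m] M)[pM cM].
have cardM : #|M| = n.
  by have := card_uniform_partition cM pM; rewrite cardsT card_ord; lia.
pose blk (k : 'I_n) : {set 'I_m} := enum_val (cast_ord (esym cardM) k).
have blkM k : blk k \in M by exact: enum_valP.
have blk_inj : injective blk by move=> k l /enum_val_inj/cast_ord_inj.
have /fin_all_exists[ab abP] : forall k, exists p : 'I_m * 'I_m,
    p.1 != p.2 /\ blk k = [set p.1; p.2].
  move=> k; have /eqP/cards2P[x [y [xy E]]] := cM _ (blkM k).
  by exists (x, y).
pose c (s : 'I_n + 'I_n) := match s with inl k => (ab k).1 | inr k => (ab k).2 end.
(* Blocks are disjoint, so a shared point identifies them; this gives injectivity of [c], and
   bijectivity follows by counting. *)
have blk_eq k l x : x \in blk k -> x \in blk l -> k = l.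
  move=> xk xl; apply: blk_inj.
  by rewrite -(def_pblock (partition_trivIset pM) (blkM k) xk);
     exact: (def_pblock (partition_trivIset pM)).
have ab1 k : (ab k).1 \in blk k by have [_ ->] := abP k; rewrite set21.
have ab2 k : (ab k).2 \in blk k by have [_ ->] := abP k; rewrite set22.
have c_inj : injective c.
  move=> [k|k] [l|l] /= E.
  - by congr inl; apply: (@blk_eq _ _ (ab k).1); rewrite // E.
  - have kl : k = l by apply: (@blk_eq _ _ (ab k).1); rewrite // E.
    by have [] := abP l; rewrite -{1}kl E eqxx.
  - have kl : k = l by apply: (@blk_eq _ _ (ab k).2); rewrite // E.
    by have [] := abP l; rewrite -E kl eqxx.
  - by congr inr; apply: (@blk_eq _ _ (ab k).2); rewrite // E.
exists c; split.
  by apply: inj_card_bij => //; rewrite card_sum !card_ord hm mul2n addnn.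
apply/setP => A; apply/idP/imsetP => [AM|[k _ ->]] /=; last first.
  by have [_ <-] := abP k.
exists (cast_ord cardM (enum_rank_in AM A)) => //=.
have [_ <-] := abP (cast_ord cardM (enum_rank_in AM A)).
by rewrite /blk cast_ordK enum_rankK_in.
Qed.

Lemma big_labelling (S : Type) (idx : S) (op : Monoid.com_law idx) (m n : nat)
    (c : 'I_n + 'I_n -> 'I_m) (P : pred 'I_m) (G : 'I_m -> S) : bijective c ->
  \big[op/idx]_(i | P i) G i =
  op (\big[op/idx]_(k | P (c (inl k))) G (c (inl k)))
     (\big[op/idx]_(k | P (c (inr k))) G (c (inr k))).
Proof. by move=> cb; rewrite (reindex c) ?big_sumType //; exact: onW_bij. Qed.

Lemma labelling_ind (m n : nat) (c : 'I_n + 'I_n -> 'I_m) (P : 'I_m -> Prop) :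
  bijective c -> (forall k, P (c (inl k))) -> (forall k, P (c (inr k))) ->
  forall i, P i.
Proof. by move=> [d _ dK] Pl Pr i; rewrite -(dK i); case: (d i). Qed.

Lemma mem_matching_subspace (F : fieldType) (m n : nat) (M : {set {set 'I_m}})
    (c : 'I_n + 'I_n -> 'I_m) (x : 'cV[F]_m) : labelling M c ->
  reflect (forall k, x (c (inr k)) 0 = - x (c (inl k)) 0)
          (x \in matching_subspace F M).
Proof.
move=> [cb MP].
have bsE k : block_sum [set c (inl k); c (inr k)] x = x (c (inl k)) 0 + x (c (inr k)) 0.
  rewrite /block_sum big_setU1 ?big_set1 // inE.
  by apply/eqP => /(bij_inj cb).
rewrite /matching_subspace memvE; apply: (iffP subv_bigcapP) => [H k|H A].
  have : [set c (inl k); c (inr k)] \in M by rewrite MP; apply/imsetP; exists k.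
  move=> /H; rewrite -memvE memv_ker lfunE /= bsE addrC addr_eq0.
  by move=> /eqP.
by rewrite MP => /imsetP[k _ ->]; rewrite -memvE memv_ker lfunE /= bsE H subrr.
Qed.

Lemma matching_subspace_inj (F : numFieldType) (m n : nat) : m = (2 * n)%N ->
  {in perfect_matchings m &, injective (@matching_subspace F m)}.
Proof.
move=> hm.
suff sub (M M' : {set {set 'I_m}}) : M \in perfect_matchings m ->
    M' \in perfect_matchings m ->
    matching_subspace F M = matching_subspace F M' -> M \subset M'.
  by move=> M M' hM hM' E; apply/eqP; rewrite eqEsubset !sub.
move=> hM hM' E.
have [c [cb MP]] := labelling_exists hm hM.
have [c' cP'] := labelling_exists hm hM'; have [[d' c'K d'K] MP'] := cP'.
apply/subsetP => A; rewrite {1}MP => /imsetP[k _ ->].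
(* The vector e_a - e_b for the block {a, b} of [M]. If it satisfies the equations of [M'], the
   [M']-partner of a must carry the entry -1, which occurs only at b; hence {a, b} is a block of
   [M']. *)
pose x : 'cV[F]_m := \col_i ((i == c (inl k))%:R - (i == c (inr k))%:R).
have ckl : (c (inl k) == c (inr k)) = false by apply/eqP => /(bij_inj cb).
have : x \in matching_subspace F M.
  apply/(mem_matching_subspace _ (conj cb MP)) => l; rewrite !mxE.
  rewrite !(inj_eq (bij_inj cb)) /= sub0r subr0; congr (- _).
rewrite E => /(mem_matching_subspace _ cP') xM'.
have two_neq0 : (1 : F) + 1 != 0 by rewrite -mulr2n pnatr_eq0.
have : x (c (inl k)) 0 = 1 by rewrite mxE eqxx ckl subr0.
have blk l : [set c' (inl l); c' (inr l)] \in M' by rewrite MP'; apply/imsetP; exists l.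
rewrite -(d'K (c (inl k))) -(d'K (c (inr k))).
case Ek: (d' (c (inl k))) => [l|l] xk.
  have := xM' l; rewrite xk !mxE.
  have -> : (c' (inr l) == c (inl k)) = false.
    by rewrite -(d'K (c (inl k))) Ek (can_eq c'K).
  rewrite sub0r => /oppr_inj; case: eqVneq => [<- _|_ /eqP]; last first.
    by rewrite eq_sym oner_eq0.
  by rewrite c'K.
have := xM' l; rewrite xk !mxE.
have -> : (c' (inl l) == c (inl k)) = false.
  by rewrite -(d'K (c (inl k))) Ek (can_eq c'K).
rewrite sub0r opprK; case: eqVneq => [<- _|_ /eqP]; last by rewrite oner_eq0.
by rewrite c'K setUC.
Qed.

Lemma fano_chart (F : numFieldType) (m n : nat) (c : 'I_n + 'I_n -> 'I_m)
    (D : 'M[F]_n) :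
  bijective c -> (forall k, D k k != 0) ->
  (forall x : 'cV[F]_m,
     (forall k, x (c (inr k)) 0 = \sum_l D k l * x (c (inl l)) 0) ->
     elem_sym m.-1 x = 0) ->
  D = - 1%:M.
Proof.
move=> cb Dkk0 De; have [c' cK c'K] := cb.
have m0 (k : 'I_n) : (0 < m)%N by apply: leq_trans (ltn_ord (c (inl k))).
pose xx (y : 'I_n -> F) : 'cV[F]_m := \col_i
  match c' i with inl k => y k | inr k => \sum_l D k l * y l end.
have xl y k : xx y (c (inl k)) 0 = y k by rewrite mxE cK.
have xr y k : xx y (c (inr k)) 0 = \sum_l D k l * y l by rewrite mxE cK.
have {De}De y : elem_sym m.-1 (xx y) = 0.
  by apply: De => k; rewrite xr; apply: eq_bigr => l _; rewrite xl.
(* On the hyperplane [y k = 0] only one term of e_(m-1) survives; it is a product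
   of linear forms, none of which vanishes at a general point of the moment
   curve if row [k] has a nonzero entry off the diagonal. *)
have Doff k l0 : l0 != k -> D k l0 = 0.
  move=> l0k; apply/eqP; apply: contraT => Dkl0.
  (* [r j] is the form x_(b_j) restricted to [y k = 0] and pulled back to the curve [y l = t ^ l].
     Distinct powers of t keep its coefficients apart. *)
  pose r j : {poly F} := \poly_(l < n) (if insub l is Some i then
    if i == k then 0 else D j i else 0).
  have rE j t : (r j).[t] = \sum_l D j l * (if l == k then 0 else t ^+ l).
    rewrite horner_poly; apply: eq_bigr => l _; rewrite valK.
    by case: eqP => _; rewrite ?mul0r ?mulr0.
  have rN j l : l != k -> D j l != 0 -> r j != 0.
    move=> lk Djl; apply: contraNneq Djl => /(congr1 (fun p : {poly F} => p`_l)).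
    by rewrite coef_poly ltn_ord coef0 valK (negPf lk) => ->.
  (* Row [k] has the nonzero entry [D k l0]; any other row [j] has its diagonal entry, which
     survives the restriction. *)
  have r0 j : r j != 0.
    have [->|jk] := eqVneq j k; first exact: (rN _ l0).
    exact: (rN _ j).
  (* The factor ['X] excludes t = 0, so that the coordinates [t ^ l] are nonzero as well. *)
  have q0 : 'X * \prod_j r j != 0.
    by rewrite mulf_neq0 ?polyX_eq0 //; apply/prodf_neq0.
  have [t] := exists_nonroot q0.
  rewrite hornerM hornerX horner_prod mulf_eq0 negb_or => /andP[t0 /prodf_neq0 rt].
  pose y l : F := if l == k then 0 else t ^+ l.
  have := De y; rewrite (@elem_sym_pred_eq0 _ _ _ (c (inl k))) => [|]; last first.
    by rewrite xl /y eqxx.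
  move/eqP; apply: contraTT => _; apply/prodf_neq0.
  apply: (labelling_ind cb) => j; last by rewrite xr -rE => _; exact: rt.
  by rewrite (inj_eq (bij_inj cb)) => jk; rewrite xl /y ifN ?expf_neq0 //.
have {}xr y k : xx y (c (inr k)) 0 = D k k * y k.
  rewrite xr (bigD1 k) //= big1 ?addr0 // => l lk.
  by rewrite Doff // mul0r.
have sum0 y : (forall k, y k != 0) -> \sum_k (1 + (D k k)^-1) / y k = 0.
  move=> y0.
  have [n0|n0] := posnP n.
    by rewrite big1 // => k; have := ltn_ord k; rewrite {2}n0.
  have xN i : xx y i 0 != 0.
    move: i; apply: (labelling_ind cb) => k; first by rewrite xl.
    by rewrite xr mulf_neq0.
  have := De y; rewrite elem_sym_pred_neq0 ?(m0 (Ordinal n0)) // => /eqP.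
  rewrite mulf_eq0 => /orP[/prodf_eq0[i _]|/eqP E]; first by rewrite (negPf (xN i)).
  rewrite -[RHS]E (big_labelling _ _ _ cb) /= -big_split /=; apply: eq_bigr => k _.
  by rewrite xl xr invfM mulrDl mul1r.
have Ddiag k : D k k = -1.
  (* Compared with the all-ones vector, only the reciprocal of coordinate [k] changes, from 1 to 2.
     Subtracting the two relations leaves [1 + (D k k)^-1 = 0]. *)
  pose z (l : 'I_n) : F := if l == k then 2^-1 else 1.
  have z0 l : z l != 0 by rewrite /z; case: ifP; rewrite ?oner_eq0 ?invr_eq0 ?pnatr_eq0.
  have := sum0 z z0; have := sum0 (fun=> 1) (fun=> oner_neq0 F).
  rewrite (bigD1 k) //= [in X in _ -> X -> _](bigD1 k) //=.
  rewrite (eq_bigr (fun l => (1 + (D l l)^-1) / z l)) => [|l lk]; last first.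
    by rewrite /z (negPf lk).
  move: (\sum_(l | _) _) => S; rewrite /z eqxx divr1 invrK mulr_natr mulr2n => S0.
  rewrite -addrA S0 addr0 => /eqP; rewrite addrC addr_eq0 => /eqP Dk.
  by rewrite -[D k k]invrK Dk invrN invr1.
apply/matrixP => k l; rewrite !mxE.
by have [->|kl] := eqVneq k l; rewrite ?mulr1n ?Ddiag // mulr0n oppr0 Doff // eq_sym.
Qed.

(** * The matrix of a labelled matching and the isolatedness of its column space *)

Definition matching_mx (F : fieldType) (m n : nat) (c : 'I_n + 'I_n -> 'I_m) :
    'M[F]_(m, n) :=
  \matrix_(i, k) ((i == c (inl k))%:R - (i == c (inr k))%:R).

Lemma matching_mx_inl (F : fieldType) (m n : nat) (c : 'I_n + 'I_n -> 'I_m) k :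
  bijective c -> row (c (inl k)) (matching_mx F c) = delta_mx 0 k.
Proof.
move=> /bij_inj ci; apply/rowP => l; rewrite !mxE !(inj_eq ci) /= subr0.
by rewrite eq_sym.
Qed.

Lemma matching_mx_inr (F : fieldType) (m n : nat) (c : 'I_n + 'I_n -> 'I_m) k :
  bijective c -> row (c (inr k)) (matching_mx F c) = - delta_mx 0 k.
Proof.
move=> /bij_inj ci; apply/rowP => l; rewrite !mxE !(inj_eq ci) /= sub0r.
by rewrite eq_sym.
Qed.

Lemma mem_column_space (F : fieldType) (m n : nat) (U : 'M[F]_(m, n)) x :
  reflect (exists v, x = U *m v) (x \in column_space U).
Proof.
apply: (iffP memv_imgP) => [[v _ ->]|[v ->]]; first by exists v; rewrite lfunE.
by exists v; rewrite ?memvf // lfunE.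
Qed.

Lemma row_mulmx_entry (F : fieldType) (m n : nat) (U : 'M[F]_(m, n))
    (v : 'cV[F]_n) i : (U *m v) i 0 = (row i U *m v) 0 0.
Proof. by rewrite -row_mul [RHS]mxE. Qed.

Lemma delta_mulmx_entry (F : fieldType) (n : nat) (v : 'cV[F]_n) k :
  ((delta_mx 0 k : 'rV[F]_n) *m v) 0 0 = v k 0.
Proof. by rewrite -rowE mxE. Qed.

Lemma column_space_matching_mx (F : fieldType) (m n : nat) (M : {set {set 'I_m}})
    (c : 'I_n + 'I_n -> 'I_m) : labelling M c ->
  column_space (matching_mx F c) = matching_subspace F M.
Proof.
move=> cM; have [cb _] := cM; apply/vspaceP => x.
have UE (v : 'cV[F]_n) k : (matching_mx F c *m v) (c (inl k)) 0 = v k 0.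
  by rewrite row_mulmx_entry matching_mx_inl // delta_mulmx_entry.
have UN (v : 'cV[F]_n) k : (matching_mx F c *m v) (c (inr k)) 0 = - v k 0.
  by rewrite row_mulmx_entry matching_mx_inr // mulNmx mxE delta_mulmx_entry.
apply/idP/idP => [/mem_column_space[v ->]|/(mem_matching_subspace _ cM) xM].
  by apply/(mem_matching_subspace _ cM) => k; rewrite UE UN.
apply/mem_column_space; exists (\col_k x (c (inl k)) 0).
apply/colP; apply: (labelling_ind cb) => k.
  by rewrite UE mxE.
by rewrite UN mxE xM.
Qed.

Lemma fano_point_matching (F : closedFieldType) (m n : nat) (M : {set {set 'I_m}})
    (c : 'I_n + 'I_n -> 'I_m) : (0 < m)%N -> labelling M c ->
  fano_point n (matching_subspace F M).
Proof.
move=> m0 cM; have [cb _] := cM; split.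
  rewrite -(column_space_matching_mx F cM) /column_space limg_dim_eq.
    by rewrite dimvf /dim /= muln1.
  apply/eqP; rewrite -subv0; apply/subvP => v; rewrite memv_cap memvf memv_ker lfunE /=.
  move=> /eqP Uv; rewrite memv0; apply/eqP/colP => k.
  rewrite -delta_mulmx_entry -(matching_mx_inl F k cb) -row_mulmx_entry Uv.
  by rewrite !mxE.
move=> x /(mem_matching_subspace _ cM) xM.
(* The terms omitting a_k and b_k share all factors but x_(b_k) and x_(a_k), which are opposite, so
   they cancel. *)
rewrite elem_sym_pred // (big_labelling _ _ _ cb) /= -big_split big1 //= => k _.
have lr : c (inl k) != c (inr k) by apply/eqP => /(bij_inj cb).
rewrite (bigD1 (c (inr k))) 1?eq_sym //= [in X in _ + X](bigD1 (c (inl k))) //=.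
rewrite xM mulNr addrC; apply/eqP; rewrite subr_eq0; apply/eqP.
by congr (_ * _); apply: eq_bigl => j; rewrite andbC.
Qed.

(* With A and B the rows of the matrix indexed by [c (inl _)] and [c (inr _)],
   the polynomial [det A * prod_k (B adj A)_kk] is nonzero exactly at the
   matrices whose column space is a graph [x_b = D x_a] with [D = B A^-1]
   having nonzero diagonal entries. *)
Lemma isolated_fano_point_matching (F : numClosedFieldType) (m n : nat)
    (M : {set {set 'I_m}}) (c : 'I_n + 'I_n -> 'I_m) :
  (0 < m)%N -> labelling M c -> isolated_fano_point n (matching_subspace F M).
Proof.
move=> m0 cM; have [cb _] := cM; split; first exact: fano_point_matching cM.
have dimM : \dim (matching_subspace F M) = n by have [] := fano_point_matching F m0 cM.
(* The indeterminate standing for the matrix entry (i, k); [PA] and [PB] are the generic versions of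
   [A] and [B]. *)
pose X i k : mpoly.mpoly (m * n) F := mpoly.mpolyX F (mpoly.mnm1 (mxvec_index i k)).
pose PA := \matrix_(k, l) X (c (inl k)) l; pose PB := \matrix_(k, l) X (c (inr k)) l.
pose p := \det PA * \prod_k (PB *m \adj PA) k k.
pose A (B' : 'M[F]_(m, n)) := rowsub (c \o inl) B'.
pose B (B' : 'M[F]_(m, n)) := rowsub (c \o inr) B'.
have pE (B' : 'M[F]_(m, n)) : mpoly.meval (fun k => mxvec B' 0 k) p =
    \det (A B') * \prod_k (B B' *m \adj (A B')) k k.
  pose ev := mpoly.meval (fun k => mxvec B' 0 k).
  have -> : A B' = map_mx ev PA.
    by apply/matrixP => k l; rewrite !mxE /ev mpoly.mevalXU mxvecE.
  have -> : B B' = map_mx ev PB.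
    by apply/matrixP => k l; rewrite !mxE /ev mpoly.mevalXU mxvecE.
  rewrite det_map_mx -map_mx_adj -map_mxM /p rmorphM rmorph_prod /=.
  by congr (_ * _); apply: eq_bigr => k _; rewrite [RHS]mxE.
exists p, (matching_mx F c); split; first exact: column_space_matching_mx.
  have A1 : A (matching_mx F c) = 1%:M.
    by apply/row_matrixP => k; rewrite row_rowsub /= matching_mx_inl // row1.
  have BN1 : B (matching_mx F c) = - 1%:M.
    by apply/row_matrixP => k; rewrite row_rowsub /= matching_mx_inr // linearN /= row1.
  have adj1 : \adj (1%:M : 'M[F]_n) = 1%:M.
    by rewrite -[LHS]mul1mx mul_mx_adj det1.
  rewrite pE A1 BN1 det1 adj1 mul1r mulmx1; apply/prodf_neq0 => k _.
  by rewrite !mxE eqxx oppr_eq0 oner_eq0.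
move=> B'; rewrite pE mulf_eq0 negb_or => /andP[detA /prodf_neq0 BadjA] [dimB' eB'].
have Au : A B' \in unitmx by rewrite unitmxE unitfE.
pose D := B B' *m invmx (A B').
have subA (v : 'cV[F]_n) k : (B' *m v) (c (inl k)) 0 = (A B' *m v) k 0.
  by rewrite row_mulmx_entry [RHS]row_mulmx_entry row_rowsub.
have subB (v : 'cV[F]_n) k : (B' *m v) (c (inr k)) 0 = (B B' *m v) k 0.
  by rewrite row_mulmx_entry [RHS]row_mulmx_entry row_rowsub.
(* [D] is [B adj A] divided by [det A], so nonvanishing of the polynomial gives the nonzero diagonal
   required by [fano_chart]. *)
have D1 : D = - 1%:M.
  apply: (fano_chart cb) => [k|x xD].
    rewrite /D /invmx Au -scalemxAr mxE mulf_neq0 ?invr_eq0 //; exact: BadjA.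
  apply: eB'; apply/mem_column_space.
  exists (invmx (A B') *m \col_k x (c (inl k)) 0).
  apply/colP; apply: (labelling_ind cb) => k.
    by rewrite subA mulKVmx // mxE.
  rewrite subB mulmxA -/D xD mxE; apply: eq_bigr => l _.
  by rewrite !mxE.
have BA : B B' = - A B'.
  by rewrite -[LHS](mulmxKV Au) -/D D1 mulNmx mul1mx.
apply/eqP; rewrite eqEdim dimB' dimM leqnn andbT.
apply/subvP => _ /mem_column_space[v ->].
by apply/(mem_matching_subspace _ cM) => k; rewrite subA subB BA mulNmx mxE.
Qed.

(** * Beam transforms of test functions *)

(* Imported only here because [classical_sets] shadows [partition], [cover],
   [trivIset] and [pblock] of [finset]. *)
From mathcomp Require Import all_classical all_reals all_analysis.

Import numFieldNormedType.Exports.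

Local Open Scope classical_set_scope.

(** * Algebra of C^k functions, and test functions *)

Section CkTheory.
Context {R : realType} {n : nat}.
Implicit Types (f g : 'rV[R]_n -> R) (k : nat).

Lemma Ck_continuous k f : Ck k f -> continuous f.
Proof. by case: k => [//|k []]. Qed.

Lemma CkS k f : Ck k.+1 f -> Ck k f.
Proof.
elim: k f => [f [] //|k IHk f [cf df]]; split=> // i.
by have [dfi /IHk] := df i.
Qed.

Lemma Ck_eq k f g : f =1 g -> Ck k f -> Ck k g.
Proof. by move=> /funext ->. Qed.

Lemma Ck_cst k (a : R) : Ck k (fun _ : 'rV[R]_n => a).
Proof.
elim: k a => [|k IHk] a /=; first exact: cst_continuous.
split=> [|i]; first exact: cst_continuous.
split=> [x|]; first exact: derivable_cst.
by apply: Ck_eq (IHk 0) => x; rewrite derive_cst.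
Qed.

Lemma Ck_add k f g : Ck k f -> Ck k g -> Ck k (fun x => f x + g x).
Proof.
elim: k f g => [|k IHk] f g /= => [cf cg x|[cf df] [cg dg]].
  by apply: continuousD; [exact: cf|exact: cg].
split=> [x|i]; first by apply: continuousD; [exact: cf|exact: cg].
have [dfi cfi] := df i; have [dgi cgi] := dg i.
split=> [x|]; first exact: derivableD.
by apply: Ck_eq (IHk _ _ cfi cgi) => x; rewrite -deriveD.
Qed.

Lemma Ck_mul k f g : Ck k f -> Ck k g -> Ck k (fun x => f x * g x).
Proof.
elim: k f g => [|k IHk] f g /= => [cf cg x|Cf Cg].
  by apply: continuousM; [exact: cf|exact: cg].
have [[cf df] [cg dg]] := (Cf, Cg).
split=> [x|i]; first by apply: continuousM; [exact: cf|exact: cg].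
have [dfi cfi] := df i; have [dgi cgi] := dg i.
split=> [x|]; first exact: derivableM.
apply: Ck_eq (Ck_add (IHk _ _ (CkS Cf) cgi) (IHk _ _ (CkS Cg) cfi)) => x.
by rewrite -deriveM.
Qed.

Lemma Ck_sum k (I : finType) (F : I -> 'rV[R]_n -> R) :
  (forall i, Ck k (F i)) -> Ck k (fun x => \sum_i F i x).
Proof.
move=> CF; elim: (index_enum I) => [|i s IHs].
  by apply: Ck_eq (Ck_cst k 0) => x; rewrite big_nil.
by apply: Ck_eq (Ck_add (CF i) IHs) => x; rewrite big_cons.
Qed.

Lemma Ck_prod k (I : finType) (F : I -> 'rV[R]_n -> R) :
  (forall i, Ck k (F i)) -> Ck k (fun x => \prod_i F i x).
Proof.
move=> CF; elim: (index_enum I) => [|i s IHs].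
  by apply: Ck_eq (Ck_cst k 1) => x; rewrite big_nil.
by apply: Ck_eq (Ck_mul (CF i) IHs) => x; rewrite big_cons.
Qed.

End CkTheory.

(** By Heine-Borel, compact support amounts to vanishing outside a ball, the form in which it is
    used for rays. *)
Lemma test_functionsP (R : realType) (n : nat) (f : 'rV[R]_n -> R) :
  test_functions R n f <->
  smooth f /\ exists N : R, forall x, N < `|x| -> f x = 0.
Proof.
split=> [[sf /compact_bounded[N [_ fN]]]|[sf [N fN]]]; split=> //.
  exists (N + 1) => x Nx; apply/eqP; apply: contraTT Nx => fx0.
  by rewrite -leNgt; apply: (fN (N + 1)); rewrite ?ltrDl //; apply: subset_closure.
apply: bounded_closed_compact; last exact: closed_closure.
have clN : closed [set x : 'rV[R]_n | `|x| <= N].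
  apply: (@closed_comp _ _ (fun x : 'rV[R]_n => `|x|) [set t | t <= N]).
    by move=> x _; exact: norm_continuous.
  exact: closed_le.
exists N; split; first exact: num_real.
move=> M NM x /= xcl; apply: le_trans (ltW NM).
suff : closure [set x | f x != 0] `<=` [set x : 'rV[R]_n | `|x| <= N] by apply.
rewrite ((closure_id _).1 clN); apply: closure_subset => y /=.
by apply: contraNT; rewrite -ltNge => /fN ->.
Qed.

Lemma test_functions_derive (R : realType) (n : nat) (f : 'rV[R]_n -> R) i :
  test_functions R n f -> test_functions R n (fun x => 'D_(delta_mx 0 i) f x).
Proof.
move=> /test_functionsP[sf [N fN]]; apply/test_functionsP; split.
  by move=> k; have [_ /(_ i)[]] := sf k.+1.
exists N => x Nx; rewrite (_ : 'D_(delta_mx 0 i) f x = 'D_(delta_mx 0 i) (cst 0) x).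
  by rewrite derive_cst.
apply: near_eq_derive; near=> y; rewrite fN //.
by near: y; exact: (cvgr_gt _ (@norm_continuous _ _ x)).
Unshelve. all: by end_near. Qed.

(** * Beam transforms as integrals over compact segments: convergence and smoothness *)

Section BeamOfTestFunction.
Context {R : realType}.
Notation mu := (@lebesgue_measure R).

Lemma patch_ray (T : R) (g : R -> R) : (forall t, t < - T -> g t = 0) ->
  g \_ `]-oo, 0] = g \_ `[- T, 0].
Proof.
move=> gT; apply/funext => t; rewrite !patchE !mem_setE !in_itv /=.
by have [/gT ->|] := ltP t (- T); rewrite ?if_same.
Qed.

Lemma Rintegral_ray (T : R) (g : R -> R) : (forall t, t < - T -> g t = 0) ->
  \int[mu]_(t in `]-oo, 0]) g t = \int[mu]_(t in `[- T, 0]) g t.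
Proof. by move=> gT; rewrite Rintegral_mkcond (patch_ray gT) -Rintegral_mkcond. Qed.

Lemma integrable_ray (T : R) (g : R -> R) : (forall t, t < - T -> g t = 0) ->
  continuous g -> mu.-integrable `]-oo, 0] (EFin \o g).
Proof.
move=> gT cg; apply/integrable_mkcond => //.
rewrite restrict_EFin (patch_ray gT) -restrict_EFin -integrable_mkcond //.
apply: continuous_compact_integrable; first exact: segment_compact.
exact: continuous_subspaceT.
Qed.

Context {n : nat}.
Implicit Types (u x : 'rV[R]_n) (f : 'rV[R]_n -> R).

(** Reverse triangle inequality. One [T] serves all starting points of norm at most [r], which makes
    the later estimates locally uniform in [x]. *)
Lemma ray_leaves_ball u (N r : R) : u != 0 ->
  exists T : R, forall x (t : R), `|x| <= r -> t < - T -> N < `|x + t *: u|.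
Proof.
move=> u0; have u_gt0 : 0 < `|u| by rewrite normr_gt0.
exists ((`|N| + `|r|) / `|u|) => x t xr; rewrite ltrNr => tT.
have t0 : t < 0.
  by rewrite -oppr_gt0; apply: le_lt_trans tT; rewrite divr_ge0 ?addr_ge0.
rewrite (le_lt_trans (ler_norm N)) // -(ltrD2r `|r|).
move: tT; rewrite ltr_pdivrMr // => /lt_le_trans; apply.
have -> : - t * `|u| = `|t *: u| by rewrite normrZ ltr0_norm.
have {1}-> : t *: u = (x + t *: u) - x by rewrite addrC addKr.
by rewrite (le_trans (ler_normB _ _)) // lerD2l (le_trans xr) // ler_norm.
Qed.

Lemma continuous_ray u x f : continuous f -> continuous (fun t : R => f (x + t *: u)).
Proof.
move=> cf t; apply: (@continuous_comp _ _ _ (fun t : R => x + t *: u) f).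
  by apply: continuousD; [exact: cst_continuous|exact: scalel_continuous].
exact: cf.
Qed.

Lemma beam_converges_test u x f : u != 0 -> test_functions R n f ->
  beam_converges u f x.
Proof.
move=> u0 /test_functionsP[sf [N fN]].
have [T xT] := ray_leaves_ball N `|x| u0.
apply: (@integrable_ray T) => [t tT|]; first exact/fN/xT.
by apply: continuous_ray; exact: (Ck_continuous (sf 0%N)).
Qed.

(** Near [x0] all the integrals run over one fixed segment, on which the integrands converge
    uniformly by compactness. *)
Lemma beam_continuous u f : u != 0 -> test_functions R n f ->
  continuous (beam u f).
Proof.
move=> u0 tf x0; have /test_functionsP[sf [N fN]] := tf.
have cf : continuous f := sf 0%N.
have [T0 xT0] := ray_leaves_ball N (`|x0| + 1) u0.
pose T : R := `|T0|.
have xT x (t : R) : `|x| <= `|x0| + 1 -> t < - T -> f (x + t *: u) = 0.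
  move=> xr tT; apply/fN/xT0 => //; apply: lt_le_trans tT _.
  by rewrite lerN2 ler_norm.
have near_ball : \forall x \near x0, `|x| <= `|x0| + 1.
  near=> x; apply/ltW; near: x.
  by apply: (cvgr_lt _ (@norm_continuous _ _ x0)); rewrite ltrDl.
have int_cont (g : R -> R) : continuous g -> mu.-integrable `[- T, 0] (EFin \o g).
  move=> cg; apply: continuous_compact_integrable; first exact: segment_compact.
  exact: continuous_subspaceT.
have cray x : continuous (fun t : R => f (x + t *: u)) by exact: continuous_ray.
have cdiff x : continuous (fun t : R => f (x0 + t *: u) - f (x + t *: u)).
  by move=> t; apply: continuousB; exact: cray.
apply/(@cvgrPdist_le _ _ _ (nbhs x0) _ (beam u f) (beam u f x0)) => e e0.
(* The segment has length at most [T], so the integral is at most [d * T <= e]; the 1 guards against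
   [T = 0]. *)
pose d := e / (T + 1).
have T1 : 0 < T + 1 by rewrite ltr_wpDl // normr_ge0.
have d0 : 0 < d by rewrite divr_gt0.
have : \forall x \near x0, `[- T, 0] `<=`
    [set t | `|f (x0 + t *: u) - f (x + t *: u)| <= d].
  have /compact_near_coveringP := @segment_compact R (- T) 0.
  move=> /(_ _ (nbhs x0) (fun x t => `|f (x0 + t *: u) - f (x + t *: u)| <= d)
             (nbhs_filter x0)).
  apply => t _ /=.
  have cv : (fun p : R * 'rV[R]_n => `|f (x0 + p.1 *: u) - f (p.2 + p.1 *: u)|)
      @ (t, x0) --> `|f (x0 + t *: u) - f (x0 + t *: u)|.
    have cu : (fun p : R * 'rV[R]_n => p.1 *: u) @ (t, x0) --> t *: u.
      by apply: cvgZr_tmp; exact: cvg_fst.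
    apply: cvg_norm; apply: cvgB.
      apply: (@cvg_comp _ _ _ (fun p : R * 'rV[R]_n => x0 + p.1 *: u) f _ _ _ _ (cf _)).
      by apply: cvgD => //; exact: cvg_cst.
    apply: (@cvg_comp _ _ _ (fun p : R * 'rV[R]_n => p.2 + p.1 *: u) f _ _ _ _ (cf _)).
    by apply: cvgD => //; exact: cvg_snd.
  by have := cvgr_le _ cv d; rewrite subrr normr0; apply.
move=> unif; near=> x.
have xb : `|x| <= `|x0| + 1 by near: x.
have fd t : - T <= t <= 0 -> `|f (x0 + t *: u) - f (x + t *: u)| <= d.
  move=> tT; suff : `[- T, 0] `<=` [set t | `|f (x0 + t *: u) - f (x + t *: u)| <= d].
    by apply; rewrite /= in_itv.
  by near: x.
rewrite /beam (Rintegral_ray (xT x0 ^~ _)) ?lerDl // (Rintegral_ray (xT x ^~ xb)).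
rewrite -RintegralB //; [|exact/int_cont/cray..].
rewrite (le_trans (le_normr_Rintegral _ _)) //; first exact/int_cont/cdiff.
apply: (@le_trans _ _ (\int[mu]_(t in `[- T, 0]) d)).
  apply: le_Rintegral => //.
  - apply: int_cont => t; apply: cvg_norm; exact: cdiff.
  - by apply: int_cont; exact: cst_continuous.
have muT : fine (lebesgue_measure (`[- T, 0] : set R)) <= T.
  rewrite lebesgue_measure_itv /= lte_fin oppr_lt0.
  by case: ifPn => /= _; rewrite ?sub0r ?opprK // normr_ge0.
rewrite Rintegral_cst // (le_trans (ler_wpM2l (ltW d0) muT)) //.
rewrite /d -mulrA ger_pMr // mulrC ler_pdivrMr // mul1r lerDl //.
Unshelve. all: by end_near. Qed.

(** The two difference quotients coincide; this reduces directional derivatives to derivatives in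
    one real variable. *)
Lemma is_derive_lineP v f y (a d : R) :
  is_derive (y + a *: v) v f d <-> is_derive a 1 (fun s : R => f (y + s *: v)) d.
Proof.
have E : (fun h : R => h^-1 *: (f (y + (h *: 1 + a) *: v) - f (y + a *: v))) =
         (fun h : R => h^-1 *: (f (h *: v + (y + a *: v)) - f (y + a *: v))).
  apply/funext => h; congr (_ *: (f _ - _)).
  by rewrite scaler1 scalerDl addrCA.
by split=> -[df dE]; apply: DeriveDef; move: df dE; rewrite /derivable /derive E.
Qed.

Lemma test_functions_bounded f : test_functions R n f ->
  exists C : R, 0 <= C /\ forall x, `|f x| <= C.
Proof.
move=> [sf csf]; have cf : continuous f := sf 0%N.
have /compact_bounded[M [_ fM]] := continuous_compact (continuous_subspaceT cf) csf.
exists (`|M| + 1); split=> [|x]; first by rewrite addr_ge0.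
have [->|fx] := eqVneq (f x) 0; first by rewrite normr0 addr_ge0.
apply: (fM (`|M| + 1)); first by rewrite ltr_pwDr // ler_norm.
by exists x => //; apply: subset_closure.
Qed.

(** Differentiation under the integral sign, dominated by a bound of [g] times the indicator of a
    segment. *)
Lemma beam_is_derive u v f g x : u != 0 ->
  test_functions R n f -> test_functions R n g ->
  (forall y, is_derive y v f (g y)) ->
  is_derive x v (beam u f) (beam u g x).
Proof.
move=> u0 tf tg dfg; have /test_functionsP[sg [N gN]] := tg.
(* The radius covers all starting points [x + s *: v] with |s| < 1. *)
have [T0 xT0] := ray_leaves_ball N (`|x| + `|v|) u0.
pose T : R := `|T0|.
have [C [C0 gC]] := test_functions_bounded tg.
pose F (s t : R) := f ((x + t *: u) + s *: v).
have FE s t : F s t = f ((x + s *: v) + t *: u) by rewrite /F addrAC.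
have dF (s t : R) : is_derive s (1 : R) (F ^~ t) (g ((x + t *: u) + s *: v)).
  exact/is_derive_lineP.
pose J : set R := `[- T, 0].
pose G t : R := C * \1_J t.
have G0 t : 0 <= G t by rewrite /G mulr_ge0.
have intG : mu.-integrable `]-oo, 0] (EFin \o G).
  apply: (integrableS measurableT) => //.
  rewrite (_ : EFin \o G = fun t => C%:E * (EFin \o \1_J) t)%E //.
  by apply: integrableZl => //; exact: integrable_indic_itv.
have intF s : `]-1, 1[%classic s -> mu.-integrable `]-oo, 0] (EFin \o F s).
  move=> _; rewrite (_ : F s = fun t => f ((x + s *: v) + t *: u)).
    exact: beam_converges_test.
  by apply/funext.
have derF s t : `]-1, 1[%classic s -> `]-oo, 0]%classic t -> derivable (F ^~ t) s 1.
  by move=> _ _; have [] := dF s t.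
have GF s t : `]-1, 1[%classic s -> `]-oo, 0]%classic t ->
    `|partial1of2 F s t| <= G t.
  rewrite /= !in_itv /= => /andP[s1 s2] t0; rewrite partial1of2E.
  have [_ ->] := dF s t; rewrite /G.
  have [tT|Tt] := ltP t (- T); last first.
    by rewrite indicE mem_set /J /= ?in_itv /= ?Tt // mulr1.
  rewrite gN ?normr0 ?G0 // addrAC; apply: xT0.
    rewrite (le_trans (ler_normD _ _)) // lerD2l normrZ ler_piMl //.
    by rewrite ltW // ltr_norml s1.
  by apply: lt_le_trans tT _; rewrite lerN2 ler_norm.
have I0 : `]-1, 1[%classic (0 : R) by rewrite /= in_itv /= ltrN10 ltr01.
have := cvg_differentiation_under_integral _ I0 intF derF G0 intG GF.
move=> /(_ (measurable_itv _)) cvF.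
have gE : beam u g x = \int[mu]_(t in `]-oo, 0]) partial1of2 F 0 t.
  apply: eq_Rintegral => t _; rewrite partial1of2E; have [_ ->] := dF 0 t.
  by rewrite scale0r addr0.
have E : (fun h : R => h^-1 *: (beam u f (h *: v + x) - beam u f x)) =
    (fun h : R => h^-1 *: (\int[mu]_(t in `]-oo, 0]) F (h + 0) t -
                           \int[mu]_(t in `]-oo, 0]) F 0 t)).
  apply/funext => h; congr (_ *: (_ - _)); apply: eq_Rintegral => t _; rewrite FE.
    by rewrite addr0 [x + h *: v]addrC.
  by rewrite scale0r addr0.
apply: DeriveDef; first by rewrite /derivable E; apply: cvgP cvF.
by rewrite /derive E gE; apply/cvg_lim.
Qed.

(** A partial derivative of a beam transform is the beam transform of the partial derivative, again
    of a test function; hence the induction generalizes over [f]. *)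
Lemma Ck_beam k u f : u != 0 -> test_functions R n f -> Ck k (beam u f).
Proof.
move=> u0; elim: k f => [|k IHk] f tf /=; first exact: beam_continuous.
split=> [|i]; first exact: beam_continuous.
have tdf := test_functions_derive i tf.
have dfi y : is_derive y (delta_mx 0 i) f ('D_(delta_mx 0 i) f y).
  apply: derivableP; have /test_functionsP[sf _] := tf.
  by have [_ /(_ i)[]] := sf 1%N.
have db x := beam_is_derive x u0 tf tdf dfi.
split=> [x|]; first by have [] := db x.
by apply: Ck_eq (IHk _ tdf) => x; have [_ ->] := db x.
Qed.

Lemma realizable_row_neq0 (m : nat) (U : 'M[R]_(m, n)) :
  (forall i, row i U != 0) -> realizable U.
Proof.
move=> U0; split=> [f tf i x|f tf k|a f g tf tg x].
- exact: beam_converges_test.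
- by apply: Ck_sum => i; exact: Ck_beam.
rewrite /star mulr_sumr -big_split; apply: eq_bigr => i _ /=.
have cvf := beam_converges_test x (U0 i) tf.
have cvg := beam_converges_test x (U0 i) tg.
rewrite /beam RintegralD //; first by rewrite RintegralZl.
exact: integrableZl cvf.
Qed.

End BeamOfTestFunction.

(** * A nonzero function in the kernel *)

Section FlatFunction.
Context {R : realType}.
Notation mu := (@lebesgue_measure R).
Implicit Types (p : {poly R}) (s t : R).

Lemma Rintegral_ray_derive (T : R) (G g : R -> R) :
  (forall t, is_derive t 1 G (g t)) -> continuous g ->
  (forall t, t < - T -> G t = 0) -> (forall t, t < - T -> g t = 0) ->
  \int[mu]_(t in `]-oo, 0]) g t = G 0.
Proof.
move=> dG cg GT gT; pose T' : R := `|T| + 1.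
have T'T t : t <= - T' -> t < - T.
  move=> /le_lt_trans; apply; rewrite ltrN2 ltr_pwDr //.
  by rewrite ler_norm.
rewrite (@Rintegral_ray _ T') => [|t /ltW/T'T/gT //].
have T'0 : - T' < 0 by rewrite oppr_lt0 ltr_pwDr.
have cG : continuous G.
  by move=> t; apply/differentiable_continuous/derivable1_diffP; have [] := dG t.
rewrite /Rintegral (continuous_FTC2 T'0 (F := G)) => [|||].
- by rewrite (GT (- T')) ?T'T //= subr0.
- exact: continuous_subspaceT.
- split=> [t _||]; first by have [] := dG t.
    by apply: cvg_at_right_filter; exact: cG.
  by apply: cvg_at_left_filter; exact: cG.
- by move=> t _; rewrite derive1E; have [_ ->] := dG t.
Qed.

Lemma exprn_le_expR (k : nat) s : 0 <= s -> (s / k.+1%:R) ^+ k.+1 <= expR s.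
Proof.
move=> s0; have -> : expR s = expR (s / k.+1%:R) ^+ k.+1.
  by rewrite -expRM_natl mulrC divfK // pnatr_eq0.
rewrite lerXn2r ?nnegrE ?expR_ge0 ?divr_ge0 //.
by apply: le_trans (expR_ge1Dx _); rewrite lerDr.
Qed.

(** Induction on [p] for all [k] at once: multiplying by s costs one power of the decay. *)
Lemma horner_expRN_bound p (k : nat) :
  exists C : R, forall s, 0 < s -> `|p.[s] * expR (- s)| <= C / s ^+ k.+1.
Proof.
elim/poly_ind: p k => [|p c IHp] k.
  by exists 0 => s s0; rewrite horner0 !mul0r normr0.
have [C pC] := IHp k.+1.
exists (C + `|c| * k.+1%:R ^+ k.+1) => s s0.
rewrite hornerD hornerM hornerX hornerC mulrDl mulrDl (le_trans (ler_normD _ _)) //.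
apply: lerD.
  rewrite mulrAC normrM (gtr0_norm s0) -ler_pdivlMr // (le_trans (pC _ s0)) //.
  by rewrite -mulrA -invfM -exprSr.
rewrite normrM -mulrA ler_wpM2l // ger0_norm ?expR_ge0 // expRN.
rewrite ler_pdivlMr ?exprn_gt0 // mulrC ler_pdivrMr ?expR_gt0 // mulrC.
rewrite -ler_pdivrMr ?exprn_gt0 ?ltr0n // -expr_div_n.
exact/exprn_le_expR/ltW.
Qed.

Definition flat p t : R := if 0 < t then p.[t^-1] * expR (- t^-1) else 0.

Lemma flat_le0 p t : t <= 0 -> flat p t = 0.
Proof. by rewrite /flat leNgt => /negPf ->. Qed.

(** Chain rule for p(1/t) exp(-1/t), written in the variable 1/t. The family is thus closed under
    differentiation, whence its smoothness. *)
Definition flat_derive p : {poly R} := 'X^2 * (p - p^`()).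

Lemma flat_is_derive p t : is_derive t 1 (flat p) (flat (flat_derive p) t).
Proof.
have [t0|t0|->] := ltgtP t 0.
- rewrite flat_le0 ?ltW //.
  apply: (@near_eq_is_derive _ _ _ (cst 0)).
  by near=> s; rewrite flat_le0 // ltW //; near: s; exact: lt_nbhsl.
- apply: (@near_eq_is_derive _ _ _ ((horner p \o GRing.inv) * (expR \o (-%R \o GRing.inv)))).
    by near=> s; rewrite /flat ifT //; near: s; exact: lt_nbhsr.
  have tn0 : t != 0 by rewrite gt_eqF.
  have dV : is_derive t (1 : R) GRing.inv (- t ^- 2).
    by apply: is_derive_eq; [exact: (@is_deriveV _ id)|rewrite /GRing.scale /= mulr1].
  apply: is_derive_eq.
  rewrite /flat t0 /flat_derive hornerM hornerXn hornerD hornerN /GRing.scale /=.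
  by rewrite exprVn; ring.
- rewrite flat_le0 //; apply/is_derive1_caratheodory.
  have [C pC] := horner_expRN_bound p 1.
  have norm_linear0 : (fun z : R => `|C| * `|z|) @ (0 : R) --> (0 : R).
    rewrite -[X in _ --> X](mulr0 `|C|); apply: cvgM; first exact: cvg_cst.
    by rewrite -[X in _ --> X](normr0 R); exact: norm_continuous.
  (* Carathéodory slope at 0. It is bounded by |C| |z|, because the decay estimate gives |flat p z|
     <= C z^2 for z > 0; at z = 0 the convention 0 / 0 = 0 yields the right value. *)
  exists (fun z => flat p z / z); split.
  + move=> z; rewrite [flat p 0]flat_le0 // !subr0.
    by have [->|z0] := eqVneq z 0; [rewrite mulr0 flat_le0|rewrite divfK].
  + rewrite /prop_for /continuous_at /= (flat_le0 p (lexx 0)) // mul0r.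
    apply: (@squeeze_cvgr _ _ _ _ (fun z => - (`|C| * `|z|)) (fun z => `|C| * `|z|)).
    * near=> z; rewrite -ler_norml normrM.
      have [z0|z0] := leP z 0; first by rewrite flat_le0 // normr0 mul0r mulr_ge0.
      rewrite normfV ler_pdivrMr ?normr_gt0 ?gt_eqF // /flat z0.
      have := pC z^-1; rewrite invr_gt0 => /(_ z0) /le_trans; apply.
      rewrite exprVn invrK (gtr0_norm z0) -mulrA -expr2 ler_wpM2r ?ler_norm //.
      by rewrite exprn_ge0 ?ltW.
    * rewrite -[X in _ --> X]oppr0; apply: cvgN; exact: norm_linear0.
    * exact: norm_linear0.
  + by rewrite flat_le0 // mul0r.
Unshelve. all: by end_near. Qed.

Lemma flat_continuous p : continuous (flat p).
Proof.
move=> t; apply/differentiable_continuous/derivable1_diffP.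
by have [] := flat_is_derive p t.
Qed.

End FlatFunction.

(** * A bump function supported in [0, 1] and the product of its derivatives *)

Section BumpFunction.
Context {R : realType}.
Implicit Types (t : R) (p : {poly R}).

Definition bump t : R := flat 1 t * flat 1 (1 - t).

Definition bump' t : R := flat (flat_derive 1) t * flat 1 (1 - t) -
                          flat 1 t * flat (flat_derive 1) (1 - t).

Lemma bump_is_derive t : is_derive t 1 bump (bump' t).
Proof.
have dB : is_derive t (1 : R) (fun s => 1 - s) (-1).
  by apply: is_derive_eq; rewrite add0r mul1r.
have d1 := flat_is_derive 1 t; have d2 := flat_is_derive 1 (1 - t).
have d2' := @is_derive1_comp R (flat 1) (fun s : R => 1 - s) t _ _ d2 dB.
apply: (@is_derive_eq _ _ _ _ _ _ _ _ (is_deriveM d1 d2')).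
by rewrite /bump' /GRing.scale /=; ring.
Qed.

Lemma bump'_continuous : continuous bump'.
Proof.
have cB : continuous (fun s : R => 1 - s).
  by move=> t; apply: continuousB; [exact: cst_continuous|exact: cvg_id].
have cF p : continuous (fun s : R => flat p (1 - s)).
  by move=> t; apply: (@continuous_comp _ _ _ (fun s : R => 1 - s) (flat p));
     [exact: cB|exact: flat_continuous].
move=> t; apply: (@continuousB _ _ _
    (fun s => flat (flat_derive 1) s * flat 1 (1 - s))
    (fun s => flat 1 s * flat (flat_derive 1) (1 - s)));
  apply: continuousM; solve [exact: flat_continuous|exact: cF].
Qed.

Lemma bump_eq0 t : ~~ (0 < t < 1) -> bump t = 0 /\ bump' t = 0.
Proof.
rewrite negb_and -!leNgt -[1 <= t]subr_le0 /bump /bump' => /orP[t0|t1].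
  by rewrite !(flat_le0 _ t0) !mul0r subrr.
by rewrite !(flat_le0 _ t1) !mulr0 subrr.
Qed.

(** At 1/2 the derivative vanishes by symmetry; at 1/4 it is a positive multiple, 16 - 16/9 = 128/9,
    of two exponentials. *)
Lemma bump'_neq0 : bump' 4^-1 != 0.
Proof.
have h1 : 0 < 4^-1 :> R by lra.
have h2 : 0 < 1 - 4^-1 :> R by lra.
rewrite /bump' /flat h1 h2 /flat_derive.
rewrite derivC subr0 mulr1 !hornerXn !hornerC !mul1r.
set a := expR _; set b := expR _.
have -> : (1 - 4^-1 : R)^-1 ^+ 2 = 16 / 9 by field.
have a0 : 0 < a by exact: expR_gt0.
have b0 : 0 < b by exact: expR_gt0.
rewrite invrK (_ : _ - _ = a * b * (128 / 9)); last by field.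
by rewrite gt_eqF // !mulr_gt0 // invr_gt0.
Qed.

Context {n : nat}.
Implicit Types x : 'rV[R]_n.

(** A partial derivative is a constant times the same expression with [flat_derive p], so the
    induction on [k] runs over all [p]. *)
Lemma Ck_flat_coord k p (a b : R) (j : 'I_n) :
  Ck k (fun x : 'rV[R]_n => flat p (a * x 0 j + b)).
Proof.
have cont q : continuous (fun x : 'rV[R]_n => flat q (a * x 0 j + b)).
  move=> x; apply: (@continuous_comp _ _ _ (fun x : 'rV[R]_n => a * x 0 j + b) (flat q)).
    apply: continuousD; last exact: cst_continuous.
    by apply: continuousM; [exact: cst_continuous|exact: coord_continuous].
  exact: flat_continuous.
elim: k p => [|k IHk] p /=; first exact: cont.
split=> [|i]; first exact: cont.
have dp x : is_derive x (delta_mx 0 i) (fun x : 'rV[R]_n => flat p (a * x 0 j + b))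
    (a * (j == i)%:R * flat (flat_derive p) (a * x 0 j + b)).
  have -> : x = x + 0 *: delta_mx 0 i by rewrite scale0r addr0.
  apply/is_derive_lineP; rewrite scale0r addr0.
  pose g (s : R) := (a * (j == i)%:R) * s + (a * x 0 j + b).
  have dg : is_derive (0 : R) (1 : R) g (a * (j == i)%:R).
    by apply: is_derive_eq; rewrite /GRing.scale /= mulr1 addr0.
  have g0 : g 0 = a * x 0 j + b by rewrite /g mulr0 add0r.
  have := @is_derive1_comp R (flat p) g 0 _ _ (flat_is_derive p (g 0)) dg; rewrite g0 mulrC.
  congr is_derive; apply/funext => s; rewrite /= /g !mxE /=; congr flat.
  by ring.
split=> [x|]; first by have [] := dp x.
apply: Ck_eq (Ck_mul (Ck_cst k (a * (j == i)%:R)) (IHk (flat_derive p))) => x.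
by have [_ ->] := dp x.
Qed.

Definition kernel_function x : R := \prod_j bump' (x 0 j).

Lemma kernel_function_test : test_functions R n kernel_function.
Proof.
apply/test_functionsP; split=> [k|].
  apply: Ck_prod => j; rewrite /bump'.
  have C1 p : Ck k (fun x : 'rV[R]_n => flat p (x 0 j)).
    by apply: Ck_eq (Ck_flat_coord k p 1 0 j) => x; rewrite mul1r addr0.
  have C2 p : Ck k (fun x : 'rV[R]_n => flat p (1 - x 0 j)).
    by apply: Ck_eq (Ck_flat_coord k p (-1) 1 j) => x; rewrite mulN1r addrC.
  apply: Ck_eq (Ck_add (Ck_mul (C1 (flat_derive 1)) (C2 1))
    (Ck_mul (Ck_cst k (-1)) (Ck_mul (C1 1) (C2 (flat_derive 1))))) => x.
  by rewrite mulN1r.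
exists 1 => x; apply: contraTeq => /prodf_neq0 fx; rewrite -leNgt.
rewrite [leLHS]/Num.norm /= mx_normrE; apply: bigmax_le => //= -[i j] _.
rewrite /= ord1; have := fx j isT; apply: contraR; rewrite -ltNge => xj.
rewrite (bump_eq0 _).2 //; apply: contraTN xj => /andP[x0 x1].
by rewrite -leNgt gtr0_norm ?ltW.
Qed.

Lemma kernel_function_neq0 : kernel_function (const_mx 4^-1) != 0.
Proof. by apply/prodf_neq0 => j _; rewrite mxE bump'_neq0. Qed.

(** The condition on [s] encodes a sign. Along the ray only factor [k] varies, with antiderivative
    [s * bump (x 0 k + s * t)] as [s * s = 1]. The result is odd in [s], so the beams in opposite
    directions cancel. *)
Lemma beam_kernel_function (k : 'I_n) (s : R) x : s * s = 1 ->
  beam (s *: delta_mx 0 k) kernel_function x =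
  s * (bump (x 0 k) * \prod_(j | j != k) bump' (x 0 j)).
Proof.
move=> ss1; set P := \prod_(j | _) _.
have fE t : kernel_function (x + t *: (s *: delta_mx 0 k)) = bump' (x 0 k + s * t) * P.
  rewrite /kernel_function (bigD1 k) //= !mxE !eqxx mulr1 mulrC [t * s]mulrC mulrC.
  congr (_ * _); apply: eq_bigr => j jk.
  by rewrite !mxE (negPf jk) !mulr0 addr0.
(* Here |s t| = -t exceeds |x_k| + 1, which pushes the argument out of (0, 1). *)
have far t : t < - (`|x 0 k| + 1) -> ~~ (0 < x 0 k + s * t < 1).
  move=> tT; apply/negP => /andP[h0 h1].
  have s1 : `|s| = 1.
    apply/eqP; rewrite -(@eqrXn2 _ 2) // ?expr1n // -normrX expr2 ss1 normr1 //.
  have t0 : t < 0 by apply: lt_trans tT _; rewrite oppr_lt0 ltr_pwDr.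
  have : `|s * t| = - t by rewrite normrM s1 mul1r ltr0_norm.
  have := ler_norm (x 0 k); have := ler_norm (- x 0 k); rewrite normrN.
  move: tT; case: (ger0P (s * t)) => _ ? ? ? ?; lra.
have dG t : is_derive t (1 : R) (fun t => (s * P) * bump (x 0 k + s * t))
    (bump' (x 0 k + s * t) * P).
  have dg : is_derive t (1 : R) (fun t => x 0 k + s * t) s.
    by apply: is_derive_eq; rewrite add0r mul1r /GRing.scale /= mulr1.
  have dc := @is_derive1_comp R bump (fun t => x 0 k + s * t) t _ _ (bump_is_derive _) dg.
  apply: (@is_derive_eq _ _ _ _ _ _ _ _ (@is_deriveZ _ _ _ _ (s * P) _ _ _ dc)).
  by rewrite /GRing.scale /=; ring: ss1.
rewrite /beam; under eq_Rintegral do rewrite fE.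
rewrite (@Rintegral_ray_derive _ (`|x 0 k| + 1) _ _ dG) => [||t tT|t tT].
- by rewrite mulr0 addr0; ring.
- move=> t; apply: cvgM; last exact: cvg_cst.
  apply: (@continuous_comp _ _ _ (fun t : R => x 0 k + s * t) bump');
    last exact: bump'_continuous.
  apply: continuousD; first exact: cst_continuous.
  by apply: continuousM; [exact: cst_continuous|exact: cvg_id].
- by rewrite (bump_eq0 (far _ tT)).1 mulr0.
- by rewrite (bump_eq0 (far _ tT)).2 mul0r.
Qed.

Lemma non_invertible_matching_mx (m : nat) (c : 'I_n + 'I_n -> 'I_m) :
  bijective c -> non_invertible (matching_mx R c).
Proof.
move=> cb inj.
have t0 : test_functions R n (fun=> 0).
  by apply/test_functionsP; split=> [k|]; [exact: Ck_cst|exists 0].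
have : kernel_function = fun=> 0.
  apply: inj; rewrite ?inE //; first exact: kernel_function_test.
  apply/funext => x; rewrite /star [RHS]big1 => [|i _]; last first.
    by rewrite /beam /Rintegral integral0.
  (* Pairing the rows at a_k and b_k, which are opposite unit vectors, makes each pair of beams sum
     to zero. *)
  rewrite (big_labelling _ _ _ cb) /= -big_split big1 //= => k _.
  rewrite matching_mx_inl // matching_mx_inr // -[X in beam X _ _ + _]scale1r -scaleN1r.
  by rewrite !beam_kernel_function ?mulrNN ?mulr1 // mul1r mulN1r subrr.
move=> /(congr1 (fun f => f (const_mx 4^-1))) /eqP.
by rewrite (negPf kernel_function_neq0).
Qed.

End BumpFunction.

Close Scope classical_set_scope.

Theorem theorem5p4 (R : realType) (n m : nat) (hn : (2 <= n)%N)
    (hm : m = (2 * n)%N) :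
  [/\ #|perfect_matchings m| = (m`! %/ (2 ^ n * n`!))%N,
      {in perfect_matchings m &, injective (@matching_subspace R[i] m)},
      forall M : {set {set 'I_m}}, M \in perfect_matchings m ->
        isolated_fano_point n (matching_subspace R[i] M) &
      forall M : {set {set 'I_m}}, M \in perfect_matchings m ->
        exists U : 'M[R]_(m, n),
          [/\ forall i, row i U != 0,
              column_space U = matching_subspace R M,
              realizable U &
              non_invertible U]].
Proof.
have m0 : (0 < m)%N by rewrite hm muln_gt0 (leq_trans _ hn).
split.
- have c2n : #|[set: 'I_m]%SET| = (2 * n)%N by rewrite cardsT card_ord hm.
  have := card_pair_partitions c2n; rewrite -hm => <-.
  by rewrite mulnK // muln_gt0 expn_gt0 fact_gt0.
- exact (@matching_subspace_inj R[i] m n hm).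
- move=> M /(labelling_exists hm)[c cM]; exact: isolated_fano_point_matching cM.
move=> M /(labelling_exists hm)[c cM]; have [cb _] := cM.
have delta0 k : (delta_mx 0 k : 'rV[R]_n) != 0.
  by apply/eqP => /rowP/(_ k)/eqP; rewrite !mxE !eqxx oner_eq0.
have U0 i : row i (matching_mx R c) != 0.
  move: i; apply: (labelling_ind cb) => k; rewrite ?matching_mx_inl ?matching_mx_inr //.
  by rewrite oppr_eq0.
exists (matching_mx R c); split=> //.
- exact: column_space_matching_mx.
- exact: realizable_row_neq0.
- exact: non_invertible_matching_mx.
Qed.
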